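(* Let $(X,\rho,\mathcal{S})$ be an unbounded complete hyperbolic space, let $\theta\in X$, let $\phi$ be an admissible function, let $s\geq1$ and let $\mathcal{M}$ be the set of all nonexpansive self-mappings of $X$. There is a subset $\mathcal{N}\subset\mathcal{M}$ which is $\sigma$-porous both in $(\mathcal{M},d_{\theta,\phi})$ and in $(\mathcal{M},d_{\theta,s})$ such that for every $f\in\mathcal{M}\setminus\mathcal{N}$ the set \[ R(f):=\{x\in X\colon\operatorname{Lip}(f,x)=1\} \] is a residual subset of $X$.
   Context: Hyperbolic spaces. A geodesic metric space is a metric space $(X,\rho)$ such that for all $x,y\in X$ there is an isometric embedding $c\colon[0,\rho(x,y)]\to X$ with $c(0)=x$, $c(\rho(x,y))=y$; the image of such a $c$ is a metric segment connecting $x$ and $y$. A hyperbolic space is a triple $(X,\rho,\mathcal{S})$ where $(X,\rho)$ is a geodesic metric space and $\mathcal{S}$ is a family of metric segments such that: (1) for each pair $x,y\in X$, $\mathcal{S}$ contains a unique metric segment connecting $x$ and $y$, denoted $[x,y]$; (2) for all $x,y\in X$ and $z,w\in[x,y]$ we have $[z,w]\subset[x,y]$; (3) $\rho((1-\lambda)x\oplus\lambda y,(1-\lambda)x\oplus\lambda z)\leq\lambda\rho(y,z)$ for all $x,y,z\in X$ and $\lambda\in[0,1]$, where $(1-\lambda)x\oplus\lambda y$ denotes the unique point of $[x,y]$ at distance $\lambda\rho(x,y)$ from $x$ and $(1-\lambda)\rho(x,y)$ from $y$. We write $\bar{B}(z,r)=\{x\in X\colon\rho(x,z)\leq r\}$.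 Mappings. A mapping $f\colon X\to X$ is nonexpansive if $\rho(f(x),f(y))\leq\rho(x,y)$ for all $x,y\in X$. For $f\in\mathcal{M}$, $x\in X$, $r\in(0,\infty)$ put $\operatorname{Lip}(f,x,r)=\sup\left\{\frac{\rho(f(x),f(y))}{\rho(x,y)}\colon y\in X,\ 0<\rho(x,y)<r\right\}$ and $\operatorname{Lip}(f,x)=\lim_{r\to0^+}\operatorname{Lip}(f,x,r)$. Admissible functions. Let $I$ be $(0,1)$ or $(0,1]$. A function $\phi\colon I\to(0,\infty)$ is called admissible here if it is continuous, strictly increasing and satisfies: (C1) there is an $\eta_\phi\in I$ such that $\phi$ is concave on $(0,\eta_\phi)$ and $\phi(\eta_\phi)\geq\eta_\phi$; (C2) $\lim_{t\to0}\phi(t)=0$ and there is a $t\in I$ with $\phi(t)=1$; (C3) for every $k\in\mathbb{N}$ there is a $C_k>0$ such that $\phi^{-1}(\frac1m)\leq C_k\,\phi^{-1}(\frac1{k+m})$ for all $m\in\mathbb{N}$; (C4) $\sum_{n=1}^\infty n\,\phi^{-1}(\frac1n)$ converges. (Here $\mathbb{N}=\{1,2,\dots\}$.) Metrics. For $f,g\in\mathcal{M}$ put $d_{n,\theta}(f,g)=\sup\{\rho(f(x),g(x))\colon x\in\bar{B}(\theta,n)\}$, $d_{\theta,\phi}(f,g)=\sum_{n=1}^\infty\phi^{-1}\left(\frac1n\right)\frac{d_{n,\theta}(f,g)}{1+d_{n,\theta}(f,g)}$ and $d_{\theta,s}(f,g)=\sup_{x\in X}\frac{\rho(f(x),g(x))}{1+\rho(x,\theta)^s}$.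 Porosity. A subset $A$ of a metric space $(M,d)$ is porous at $x\in A$ if $\liminf_{r\to0}\gamma(x,r,A)/r>0$, where $\gamma(x,r,A)=\sup\{s>0\colon\exists x'\in M\text{ with }B_M(x',s)\subset B_M(x,r)\setminus A\}$, $B_M$ denotes open balls and $\sup\emptyset=-\infty$. $A$ is porous if it is porous at each of its points, and $\sigma$-porous if it is a countable union of porous sets. A subset is residual if its complement is meagre. *)

(* Defs.v *)
From HB Require Import structures.
From mathcomp Require Import all_boot all_order all_algebra.
From mathcomp Require Import all_classical all_reals all_analysis.

Set Implicit Arguments.
Unset Strict Implicit.
Unset Printing Implicit Defensive.

Import Order.TTheory GRing.Theory Num.Theory.
Import numFieldNormedType.Exports.

Local Open Scope classical_set_scope.
Local Open Scope ring_scope.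

#[short(type="completeMetricType")]
HB.structure Definition CompleteMetric (R : numDomainType) :=
  {X of Complete X & Metric R X}.

Definition unbounded_space (R : realType) (X : metricType R) : Prop :=
  ~ exists C : R, forall x y : X, mdist x y <= C.

(* Only the restriction of [c] to [0, mdist x y] matters. *)
Definition is_geodesic (R : realType) (X : metricType R)
    (x y : X) (c : R -> X) : Prop :=
  [/\ {in `[0, mdist x y] &, forall a b : R, mdist (c a) (c b) = `|a - b| },
      c 0 = x & c (mdist x y) = y].

Definition geodesic_space (R : realType) (X : metricType R) : Prop :=
  forall x y : X, exists c : R -> X, is_geodesic x y c.

Definition segment_connecting (R : realType) (X : metricType R)
    (x y : X) (A : set X) : Prop :=
  exists2 c : R -> X, is_geodesic x y c & A = c @` `[0, mdist x y].

Definition metric_segment (R : realType) (X : metricType R)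
    (A : set X) : Prop :=
  exists x y : X, segment_connecting x y A.

(* The segment [x, y]; the default [set0] is used only if the family [S]
   contains no segment connecting [x] and [y]. *)
Definition segment (R : realType) (X : metricType R) (S : set (set X))
    (x y : X) : set X :=
  xget set0 [set A | S A /\ segment_connecting x y A].

(* The point (1 - l) x (+) l y of [x, y]; the default [x] is used only if there
   is no such point. *)
Definition hconv (R : realType) (X : metricType R) (S : set (set X))
    (l : R) (x y : X) : X :=
  xget x [set z | [/\ segment S x y z, mdist x z = l * mdist x y
                    & mdist z y = (1 - l) * mdist x y]].

Definition hyperbolic (R : realType) (X : metricType R)
    (S : set (set X)) : Prop :=
  [/\ geodesic_space X,
      forall A, S A -> metric_segment A,
      forall x y : X, exists! A, S A /\ segment_connecting x y A,
      forall x y z w : X, segment S x y z -> segment S x y w ->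
        segment S z w `<=` segment S x y
    & forall (x y z : X) (l : R), 0 <= l <= 1 ->
        mdist (hconv S l x y) (hconv S l x z) <= l * mdist y z].

Definition nonexpansive (R : realType) (X : metricType R)
    (f : X -> X) : Prop :=
  forall x y : X, mdist (f x) (f y) <= mdist x y.

Record nonexpansive_map (R : realType) (X : metricType R) := NonexpansiveMap {
  nonexpansive_fun :> X -> X;
  nonexpansive_funP : nonexpansive nonexpansive_fun
}.

Definition Lip_at (R : realType) (X : metricType R)
    (f : X -> X) (x : X) (r : R) : R :=
  sup [set mdist (f x) (f y) / mdist x y | y in [set y | 0 < mdist x y < r]].

Definition Lip (R : realType) (X : metricType R) (f : X -> X) (x : X) : R :=
  lim (Lip_at f x r @[r --> 0^'+]).

Definition concave_on (R : realType) (A : set R) (phi : R -> R) : Prop :=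
  forall x y l : R, A x -> A y -> 0 <= l <= 1 ->
    (1 - l) * phi x + l * phi y <= phi ((1 - l) * x + l * y).

(* A function on [I] is represented by [phi : R -> R], whose values outside [I]
   are irrelevant; this is its inverse [phi @` I -> I]. *)
Definition inv_on (R : realType) (I : set R) (phi : R -> R) : R -> R :=
  'pinv_(fun=> 0) I phi.

Record admissible (R : realType) (I : set R) (phi : R -> R) : Prop := {
  adm_dom : I = `]0, 1[%classic \/ I = `]0, 1]%classic;
  adm_pos : forall t, I t -> 0 < phi t;
  adm_continuous : {within I, continuous phi};
  adm_increasing : forall t u, I t -> I u -> t < u -> phi t < phi u;
  adm_C1 : exists eta,
    [/\ I eta, concave_on `]0, eta[ phi & eta <= phi eta];
  adm_C2_lim : phi t @[t --> 0^'+] --> (0 : R);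
  adm_C2_one : exists2 t, I t & phi t = 1;
  adm_C3 : forall k : nat, (0 < k)%N -> exists2 C : R, 0 < C &
    forall m : nat, (0 < m)%N ->
      inv_on I phi m%:R^-1 <= C * inv_on I phi (k + m)%:R^-1;
  adm_C4 : cvgn (series (fun n => n.+1%:R * inv_on I phi n.+1%:R^-1))
}.

Definition dist_ball (R : realType) (X : metricType R) (theta : X) (n : nat)
    (f g : X -> X) : R :=
  sup [set mdist (f x) (g x) | x in [set x | mdist theta x <= n%:R]].

(* The series starts at 1, hence the shift [n.+1]. *)
Definition dist_phi (R : realType) (X : metricType R) (theta : X)
    (I : set R) (phi : R -> R) (f g : X -> X) : R :=
  limn (series (fun n => inv_on I phi n.+1%:R^-1 *
    (dist_ball theta n.+1 f g / (1 + dist_ball theta n.+1 f g)))).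

Definition dist_pow (R : realType) (X : metricType R) (theta : X) (s : R)
    (f g : X -> X) : R :=
  sup (range (fun x => mdist (f x) (g x) / (1 + mdist x theta `^ s))).

Definition dball (R : realType) (T : Type) (d : T -> T -> R)
    (x : T) (r : R) : set T :=
  [set y | d x y < r].

(* The supremum is taken in the extended reals, where [ereal_sup set0 = -oo]. *)
Definition porosity_radius (R : realType) (T : Type) (d : T -> T -> R)
    (x : T) (r : R) (A : set T) : \bar R :=
  ereal_sup [set s%:E | s in
    [set s : R | 0 < s /\ exists x', dball d x' s `<=` dball d x r `\` A]].

Definition porous_at (R : realType) (T : Type) (d : T -> T -> R)
    (A : set T) (x : T) : Prop :=
  (0 < limf_einf (fun r : R => porosity_radius d x r A * (r^-1)%:E) 0^'+)%E.

Definition porous (R : realType) (T : Type) (d : T -> T -> R)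
    (A : set T) : Prop :=
  forall x, A x -> porous_at d A x.

Definition sigma_porous (R : realType) (T : Type) (d : T -> T -> R)
    (A : set T) : Prop :=
  exists2 P : nat -> set T, (forall n, porous d (P n)) & A = \bigcup_n P n.

Definition nowhere_dense (T : topologicalType) (A : set T) : Prop :=
  interior (closure A) = set0.

Definition meagre (T : topologicalType) (A : set T) : Prop :=
  exists2 F : nat -> set T, (forall n, nowhere_dense (F n)) & A = \bigcup_n F n.

Definition residual (T : topologicalType) (A : set T) : Prop :=
  meagre (~` A).

(* Main.v *)
(* If Lip(f, -) = 1 fails on a non-meagre set, then f is (1 - 1/m)-Lipschitz on
   some ball B(z, 1/m) with z in B(theta, m), for some m; let N_m be the set of
   such f.  To see that N_m is porous, contract f towards theta by a factor
   1 - l with l comparable to the allowed distance r: by (C4), resp. s >= 1, this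
   moves f by O(l).  Choose a maximal 4R-separated set with R = 1/(8m).  Around
   each of its points p the slack l pays for collapsing the ball of radius lR to
   p, and the map, now constant there, is replaced by an isometric excursion of
   length lR along a geodesic.  These modifications have disjoint supports and
   glue to a nonexpansive map, since in a geodesic space nonexpansiveness is a
   local property.  The result g has, near every point, a pair at distance lR
   which it maps isometrically, so every h at distance o(lR) from g is not in
   N_m. *)
Require Import Defs.
From HB Require Import structures.
From mathcomp Require Import all_boot all_order all_algebra.
From mathcomp Require Import all_classical all_reals all_analysis.
From mathcomp Require Import ring lra.

Set Implicit Arguments.
Unset Strict Implicit.
Unset Printing Implicit Defensive.

Import Order.TTheory GRing.Theory Num.Theory.
Import numFieldNormedType.Exports.

Local Open Scope classical_set_scope.
Local Open Scope ring_scope.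

(** * Convex combinations and radial maps in a hyperbolic space *)

Section hyperbolic_geometry.
Variables (R : realType) (X : metricType R).
Implicit Types (x y z p : X) (l k : R).

(** A point of a geodesic is determined by its distance from the start, so the point that [hconv]
    selects by distances is a value of the parametrization [c]. Distances along one segment thereby
    become distances in the real line. *)
Lemma hconv_geodesic (S : set (set X)) : hyperbolic S -> forall x y,
  exists2 c : R -> X, is_geodesic x y c &
    forall l, 0 <= l <= 1 -> hconv S l x y = c (l * mdist x y).
Proof.
move=> [_ _ uniqS _ _] x y.
have [A [AP _]] := uniqS x y.
have [_ [c gc Ec]] : [set B | S B /\ segment_connecting x y B] (segment S x y).
  by apply: xgetPex; exists A.
exists c => // l /andP[l0 l1].
have [isoc c0 cd] := gc.
have d0 := mdist_ge0 x y.
have dD : mdist x y \in `[0, mdist x y] by rewrite in_itv/= d0 lexx.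
have oD : 0 \in `[0, mdist x y] by rewrite in_itv/= d0 lexx.
have lD : l * mdist x y \in `[0, mdist x y].
  by rewrite in_itv/= mulr_ge0//= ler_piMl.
have [] : [set z | [/\ segment S x y z, mdist x z = l * mdist x y
    & mdist z y = (1 - l) * mdist x y]] (hconv S l x y).
  apply: xgetPex; exists (c (l * mdist x y)) => /=; split.
  - by rewrite Ec; exists (l * mdist x y).
  - have := isoc _ _ oD lD; rewrite c0 => ->.
    by rewrite sub0r normrN ger0_norm// mulr_ge0.
  - have := isoc _ _ lD dD; rewrite cd => ->.
    rewrite ler0_norm; first by ring.
    by rewrite subr_le0 ler_piMl.
rewrite {1}Ec => -[t tD <-].
have t0 : 0 <= t by move: tD; rewrite /= in_itv/= => /andP[].
have := isoc _ _ oD tD; rewrite c0 => ->.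
by rewrite sub0r normrN ger0_norm// => ->.
Qed.

Section in_hyperbolic_space.
Variable S : set (set X).
Hypothesis hS : hyperbolic S.

Lemma mdist_hconv x y l k : 0 <= l <= 1 -> 0 <= k <= 1 ->
  mdist (hconv S l x y) (hconv S k x y) = `|l - k| * mdist x y.
Proof.
move=> l01 k01; have [c [isoc _ _] hc] := hconv_geodesic hS x y.
have d0 := mdist_ge0 x y.
rewrite !hc// isoc.
- by rewrite -mulrBl normrM (ger0_norm d0).
- by case/andP: l01 => l0 l1; rewrite in_itv/= mulr_ge0//= ler_piMl.
- by case/andP: k01 => l0 l1; rewrite in_itv/= mulr_ge0//= ler_piMl.
Qed.

Lemma hconv0 x y : hconv S 0 x y = x.
Proof.
have [c [_ c0 _] hc] := hconv_geodesic hS x y.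
by rewrite hc ?lexx ?ler01// mul0r.
Qed.

Lemma hconv1 x y : hconv S 1 x y = y.
Proof.
have [c [_ _ c1] hc] := hconv_geodesic hS x y.
by rewrite hc ?lexx ?ler01// mul1r.
Qed.

Lemma hconv_lipschitz x y z l : 0 <= l <= 1 ->
  mdist (hconv S l x y) (hconv S l x z) <= l * mdist y z.
Proof. by case: hS => _ _ _ _; apply. Qed.

(* The factor by which the radial map below rescales the points at distance [t]
   from its center: it collapses the ball of radius [l * r], fixes everything
   beyond [r], and is affine in the radius in between. *)
Definition radial_factor l r t : R :=
  Num.min 1 (Num.max 0 ((t - l * r) / ((1 - l) * t))).

Section radial_factor.
Variables (l r : R).
Hypotheses (l_gt0 : 0 < l) (l_lt1 : l < 1) (r0 : 0 < r).

Let lr_gt0 : 0 < l * r. Proof. by rewrite mulr_gt0. Qed.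

Lemma radial_factor01 t : 0 <= radial_factor l r t <= 1.
Proof. by rewrite /radial_factor le_min ler01 le_max lexx/= ge_min lexx. Qed.

Lemma radial_factor_small t : 0 <= t <= l * r -> radial_factor l r t = 0.
Proof.
have [l0 l1 lr0] := And3 l_gt0 l_lt1 lr_gt0.
move=> /andP[t0 tlr]; rewrite /radial_factor.
have -> : Num.max 0 ((t - l * r) / ((1 - l) * t)) = 0.
  apply/max_idPl; rewrite mulr_le0_ge0//; first by rewrite subr_le0.
  by rewrite invr_ge0 mulr_ge0//; lra.
by apply/min_idPr; exact: ler01.
Qed.

Lemma radial_factor_large t : r <= t -> radial_factor l r t = 1.
Proof.
have [l0 l1 lr0] := And3 l_gt0 l_lt1 lr_gt0.
move=> rt; rewrite /radial_factor; apply/min_idPl.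
have t0 : 0 < t := lt_le_trans r0 rt.
rewrite le_max ler_pdivlMr; last by rewrite mulr_gt0//; lra.
apply/orP; right; have : l * r <= l * t by rewrite ler_pM2l//; lra.
lra.
Qed.

Lemma radial_factor_middle t : l * r <= t -> t <= r ->
  (1 - l) * (radial_factor l r t * t) = t - l * r.
Proof.
have [l0 l1 lr0] := And3 l_gt0 l_lt1 lr_gt0.
move=> lrt tr; have t0 : 0 < t := lt_le_trans lr_gt0 lrt.
have k0 : 0 < 1 - l by lra.
have lt0 : 0 < (1 - l) * t by rewrite mulr_gt0.
rewrite /radial_factor; set a := _ / _.
have aE : a * ((1 - l) * t) = t - l * r by rewrite mulfVK// gt_eqF.
have -> : Num.max 0 a = a.
  by apply/max_idPr; rewrite divr_ge0// ?subr_ge0// ltW.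
have -> : Num.min 1 a = a.
  apply/min_idPr; rewrite ler_pdivrMr// mul1r.
  have : l * t <= l * r by rewrite ler_pM2l.
  lra.
by rewrite -aE; ring.
Qed.

Lemma radial_factor_le t : l * r <= t ->
  (1 - l) * (radial_factor l r t * t) <= t - l * r.
Proof.
have [l0 l1 lr0] := And3 l_gt0 l_lt1 lr_gt0.
move=> lrt; have [tr|/ltW rt] := leP t r; first by rewrite radial_factor_middle.
rewrite radial_factor_large// mul1r.
have : l * r <= l * t by rewrite ler_pM2l.
lra.
Qed.

Lemma radial_factor_mono t u : 0 <= t -> t <= u ->
  radial_factor l r t <= radial_factor l r u.
Proof.
have [l0 l1 lr0] := And3 l_gt0 l_lt1 lr_gt0.
move=> t0 tu; have [ur|/ltW ru] := leP u r; last first.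
  by rewrite (radial_factor_large ru); have /andP[] := radial_factor01 t.
have [lrt|/ltW tlr] := leP (l * r) t; last first.
  by rewrite radial_factor_small ?t0//; have /andP[] := radial_factor01 u.
have Et := radial_factor_middle lrt (le_trans tu ur).
have Eu := radial_factor_middle (le_trans lrt tu) ur.
have t1 : 0 < t := lt_le_trans lr_gt0 lrt.
have u1 : 0 < u := lt_le_trans t1 tu.
have a0 : 0 < (1 - l) * (t * u) by rewrite mulr_gt0 ?mulr_gt0//; lra.
(* Clearing denominators by [(1 - l) * (t * u)] turns both sides into expressions given by
   [radial_factor_middle] and leaves [l * r * t <= l * r * u]. *)
rewrite -(ler_pM2l a0).
have -> : (1 - l) * (t * u) * radial_factor l r t =
  u * ((1 - l) * (radial_factor l r t * t)) by ring.
have -> : (1 - l) * (t * u) * radial_factor l r u =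
  t * ((1 - l) * (radial_factor l r u * u)) by ring.
have : l * r * t <= l * r * u by rewrite ler_pM2l.
rewrite Et Eu; lra.
Qed.

Definition radial_map p x : X := hconv S (radial_factor l r (mdist p x)) p x.

Lemma mdist_radial_map p x :
  mdist p (radial_map p x) = radial_factor l r (mdist p x) * mdist p x.
Proof.
have [l0 l1 lr0] := And3 l_gt0 l_lt1 lr_gt0.
have f01 := radial_factor01 (mdist p x).
rewrite -[X in mdist X _](hconv0 p x) mdist_hconv// ?lexx ?ler01//.
by rewrite sub0r normrN ger0_norm//; case/andP: f01.
Qed.

Lemma radial_map_far p x : r <= mdist p x -> radial_map p x = x.
Proof. by move=> rx; rewrite /radial_map radial_factor_large// hconv1. Qed.

Lemma mdist_radial_map_id p x : mdist (radial_map p x) x <= l * r.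
Proof.
have [l0 l1 lr0] := And3 l_gt0 l_lt1 lr_gt0.
have f01 := radial_factor01 (mdist p x).
rewrite -[X in mdist _ X](hconv1 p x) mdist_hconv// ?lexx ?ler01//.
rewrite distrC ger0_norm; last by rewrite subr_ge0; case/andP: f01.
have d0 := mdist_ge0 p x.
have [rd|/ltW dr] := leP r (mdist p x).
  by rewrite radial_factor_large// subrr mul0r ltW.
have [lrt|/ltW tlr] := leP (l * r) (mdist p x); last first.
  by rewrite radial_factor_small ?d0// subr0 mul1r.
(* In the annulus the displacement is [t - f * t = l * r - l * (f * t)]. *)
have := radial_factor_middle lrt dr; case/andP: f01.
set f := radial_factor _ _ _; move: (mdist p x) d0 lrt dr => t t0 *.
have : 0 <= f * t by rewrite mulr_ge0.
nra.
Qed.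

(** With [y] farther from [p] than [x], pass through the point of the segment from [p] to [y] that
    uses the factor of [x]: condition (3) of hyperbolicity bounds the first leg, and the second runs
    along one segment. *)
Lemma radial_map_lipschitz p x y :
  (1 - l) * mdist (radial_map p x) (radial_map p y) <= mdist x y.
Proof.
have [l0 l1 lr0] := And3 l_gt0 l_lt1 lr_gt0.
wlog xy : x y / mdist p x <= mdist p y => [wlogh|].
  have [/wlogh//|/ltW/wlogh] := leP (mdist p x) (mdist p y).
  by rewrite metric_sym (metric_sym y).
have fx := radial_factor01 (mdist p x).
have fy := radial_factor01 (mdist p y).
have tri : mdist (radial_map p x) (radial_map p y) <=
    radial_factor l r (mdist p x) * mdist x y +
    (radial_factor l r (mdist p y) - radial_factor l r (mdist p x)) * mdist p y.
  apply: le_trans (metric_triangle _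
    (hconv S (radial_factor l r (mdist p x)) p y) _) _.
  apply: lerD; first exact: hconv_lipschitz.
  rewrite mdist_hconv// distrC ger0_norm// subr_ge0 radial_factor_mono//.
  exact: mdist_ge0.
have dx := mdist_ge0 p x.
have dy := mdist_ge0 p y.
have txy := metric_triangle p x y.
have [rd|/ltW dr] := leP r (mdist p x).
  move: tri; rewrite !radial_factor_large//; last exact: le_trans rd xy.
  have := mdist_ge0 (radial_map p x) (radial_map p y); nra.
have [lry|/ltW ylr] := leP (l * r) (mdist p y); last first.
  move: tri; rewrite !radial_factor_small ?dx ?dy//; last exact: le_trans xy ylr.
  have := mdist_ge0 x y.
  have := mdist_ge0 (radial_map p x) (radial_map p y); nra.
have := radial_factor_le lry.
have k0 : 0 < 1 - l by lra.
rewrite -(ler_pM2l k0) in tri => hy; apply: (le_trans tri).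
have [lrx|/ltW xlr] := leP (l * r) (mdist p x); last first.
  rewrite (radial_factor_small (t := mdist p x)) ?dx// in tri *.
  by rewrite mul0r add0r subr0; lra.
have hx := radial_factor_middle lrx dr.
have tx : 0 < mdist p x := lt_le_trans lr_gt0 lrx.
case/andP: fx => fx0 fx1.
move: hx hy fx0; set f := radial_factor _ _ _; set g := radial_factor _ _ _.
move: txy xy tx; set a := mdist p x; set b := mdist p y; set d := mdist x y.
move=> txy xy tx hx hy f0.
(* Nonnegativity of [1 - (1 - l) * f] allows [b - a <= d] to be multiplied by it; the bounds for the
   two legs then add up to [d]. *)
have bnd : (1 - l) * f <= 1.
  by rewrite -(ler_pM2r tx) mul1r -mulrA hx; lra.
have := mulr_ge0 (mulr_ge0 (ltW k0) f0) (mdist_ge0 x y).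
have : (1 - (1 - l) * f) * (b - a) <= (1 - (1 - l) * f) * d.
  by apply: ler_wpM2l; lra.
lra.
Qed.

End radial_factor.
End in_hyperbolic_space.
End hyperbolic_geometry.

(** * Local criterion for nonexpansiveness, and perturbations of strict contractions *)

Section nonexpansive_maps.
Variables (R : realType) (X : metricType R).
Implicit Types (x y z p : X).

Lemma mdist_sub_le p x y : `|mdist p x - mdist p y| <= mdist x y.
Proof.
have := metric_triangle p x y; have := metric_triangle p y x.
by rewrite (metric_sym y x) ler_norml; lra.
Qed.

(** Continuity method along a geodesic from [x] to [y]: the supremum of the times in [A] belongs to
    [A], and the local bound around it would push it further if it were below [D]. *)
Lemma local_nonexpansive (G : X -> X) : geodesic_space X ->
  (forall x, exists2 e, 0 < e &
     forall y, mdist x y < e -> mdist (G x) (G y) <= mdist x y) ->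
  nonexpansive G.
Proof.
move=> geoX locG x y; have [c [isoc c0 cD]] := geoX x y.
have D0 := mdist_ge0 x y; set D := mdist x y in isoc cD D0 *.
pose A := [set t | 0 <= t <= D /\ mdist (G x) (G (c t)) <= t].
have A0 : A 0 by rewrite /A/= lexx c0 mdistxx.
have supA : has_sup A by split; [exists 0 | exists D => t [/andP[]]].
have T0 : 0 <= sup A by apply: ub_le_sup => //; case: supA.
have TD : sup A <= D by apply: sup_le_ub => [|t [/andP[]]]//; exists 0.
have TI : sup A \in `[0, D] by rewrite in_itv/= T0.
have [e e0 He] := locG (c (sup A)).
have AT : mdist (G x) (G (c (sup A))) <= sup A.
  have [t At tT] := sup_adherent e0 supA.
  have tT' : t <= sup A by apply: ub_le_sup => //; case: supA.
  have [/andP[t0 tD] tG] := At.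
  have tI : t \in `[0, D] by rewrite in_itv/= t0.
  have := He (c t); rewrite isoc// ger0_norm ?subr_ge0// => /(_ _).
  have := metric_triangle (G x) (G (c t)) (G (c (sup A))).
  rewrite (metric_sym (G (c t))) => tri /(_ ltac:(lra)) h.
  lra.
have [TltD|DleT] := ltP (sup A) D; last first.
  have TE : sup A = D by apply/eqP; rewrite eq_le TD.
  by rewrite TE cD in AT.
pose u := Num.min (sup A + e / 2) D.
have uT : sup A < u by rewrite lt_min TltD andbT ltrDl divr_gt0.
have ue : u <= sup A + e / 2 by rewrite ge_min lexx.
have uD : u <= D by rewrite ge_min lexx orbT.
have uI : u \in `[0, D] by rewrite in_itv/= uD; lra.
suff Au : A u by have : u <= sup A by [apply: ub_le_sup => //; case: supA]; lra.
split; first by rewrite uD; lra.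
have := He (c u); rewrite isoc// ltr0_norm ?subr_lt0// => /(_ ltac:(lra)) h.
have := metric_triangle (G x) (G (c (sup A))) (G (c u)); lra.
Qed.

(** If every point were closer than [r] to [x], the diameter would be at most [r + r]. A geodesic to
    a point at distance at least [r] is long enough. *)
Lemma exists_ray x (r : R) : geodesic_space X -> unbounded_space X ->
  exists2 c : R -> X, c 0 = x &
    {in `[0, r] &, forall a b : R, mdist (c a) (c b) = `|a - b|}.
Proof.
move=> geoX unbX; have [q rq] : exists q, r <= mdist x q.
  apply: contrapT => /forallNP nq; apply: unbX; exists (r + r) => y z.
  have /negP := nq y; have /negP := nq z; rewrite -!ltNge.
  have := metric_triangle y x z; rewrite (metric_sym y x); lra.
have [c [isoc c0 _]] := geoX x q; exists c => // a b.
rewrite !in_itv/= => /andP[a0 ar] /andP[b0 br].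
by apply: isoc; rewrite in_itv/= ?a0 ?b0/=; apply: le_trans rq.
Qed.

Lemma maximal_separated_set (r : R) : 0 < r -> exists A : set X,
  (forall p q, A p -> A q -> mdist p q < r -> p = q) /\
  (forall x, exists2 p, A p & mdist p x < r).
Proof.
move=> r0.
pose P := [set A : set X | forall p q, A p -> A q -> mdist p q < r -> p = q].
have [F FP Ftot|A [PA maxA]] := @Zorn_bigcup _ P.
  move=> p q [A FA Ap] [B FB Bq].
  have [AB|BA] := Ftot _ _ FA FB; first exact: (FP _ FB) (AB _ Ap) Bq.
  exact: (FP _ FA) Ap (BA _ Bq).
exists A; split=> // x; apply: contrapT => nx.
have far p : A p -> mdist p x < r -> False by move=> Ap px; apply: nx; exists p.
apply: (maxA (A `|` [set x])).
  rewrite properEneq; split; last exact: subsetUl.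
  apply/eqP => E; apply: (far x); last by rewrite mdistxx.
  by rewrite E; right.
move=> p q [Ap|->] [Aq|->]//; first exact: PA.
  by move/(far _ Ap).
by rewrite metric_sym => /(far _ Aq).
Qed.

Section perturbation.
Variable S : set (set X).
Hypotheses (hS : hyperbolic S) (hX : unbounded_space X).
Variables (l r : R).
Hypotheses (l_gt0 : 0 < l) (l_lt1 : l < 1) (r_gt0 : 0 < r).

Let geoX : geodesic_space X. Proof. by case: hS. Qed.

(* The contracted map [F] has enough slack to be precomposed with the radial
   map at [p]; being then constant near [p], it can be replaced there by an
   isometric excursion along a geodesic issued from [F p]. *)
Lemma exists_bump (F : X -> X) p :
  (forall x y, mdist (F x) (F y) <= (1 - l) * mdist x y) ->
  exists G : X -> X, [/\ nonexpansive G,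
    forall x, r <= mdist p x -> G x = F x,
    forall x, mdist (F x) (G x) <= l * r &
    forall x, mdist p x = l * r -> mdist (G p) (G x) = l * r].
Proof.
move=> lipF; have [c c0 isoc] := exists_ray (F p) (l * r) geoX hX.
have lr0 : 0 < l * r by rewrite mulr_gt0.
have [l0 l1] := conj l_gt0 l_lt1.
have k0 : 0 < 1 - l by lra.
(* The excursion starts at [c 0 = F p] on the sphere of radius [l * r] and is farthest from [F p] at
   [p] itself. On that sphere the radial map takes the value [p], so the two formulas agree
   there. *)
pose G x := if mdist p x < l * r then c (l * r - mdist p x)
            else F (radial_map S l r p x).
have Gin x : mdist p x < l * r -> G x = c (l * r - mdist p x).
  by rewrite /G => ->.
have Gout x : l * r <= mdist p x -> G x = F (radial_map S l r p x).
  by rewrite /G ltNge => ->.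
have cI x : mdist p x < l * r -> l * r - mdist p x \in `[0, l * r].
  by move=> ?; rewrite in_itv/= subr_ge0 ltW//= gerBl mdist_ge0.
have oI : 0 \in `[0, l * r] by rewrite in_itv/= lexx ltW.
(* Through [F p] the two legs are [l * r - mdist p x] and at most [mdist p y - l * r]; the radius
   cancels. *)
have Gmix x y : mdist p x < l * r -> l * r <= mdist p y ->
    mdist (G x) (G y) <= mdist x y.
  move=> xlr lry; apply: le_trans (metric_triangle _ (F p) _) _.
  have -> : mdist (G x) (F p) = l * r - mdist p x.
    by rewrite Gin// -c0 isoc ?cI// subr0 ger0_norm// subr_ge0 ltW.
  have : mdist (F p) (G y) <= mdist p y - l * r.
    rewrite Gout//; apply: le_trans (lipF _ _) _.
    by rewrite mdist_radial_map// radial_factor_le.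
  have := metric_triangle p x y; lra.
exists G; split.
- move=> x y.
  have [xlr|lrx] := ltP (mdist p x) (l * r);
    have [ylr|lry] := ltP (mdist p y) (l * r).
  + rewrite !Gin// isoc ?cI//.
    have -> : l * r - mdist p x - (l * r - mdist p y) = mdist p y - mdist p x.
      by ring.
    by rewrite (metric_sym x) mdist_sub_le.
  + exact: Gmix.
  + by rewrite metric_sym (metric_sym x) Gmix.
  + by rewrite !Gout//; apply: le_trans (lipF _ _) _; exact: radial_map_lipschitz.
- move=> x rx; rewrite Gout ?radial_map_far//; apply: le_trans rx.
  by rewrite ler_piMl// ltW.
- move=> x; have [xlr|lrx] := ltP (mdist p x) (l * r).
    apply: le_trans (metric_triangle _ (F p) _) _.
    have -> : mdist (F p) (G x) = l * r - mdist p x.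
      rewrite Gin// -c0 isoc ?cI// sub0r normrN ger0_norm// subr_ge0.
      exact: ltW.
    have := lipF x p; rewrite (metric_sym x p).
    have : 0 <= l * mdist p x by rewrite mulr_ge0 ?mdist_ge0// ltW.
    lra.
  rewrite Gout// metric_sym; apply: le_trans (lipF _ _) _.
  have := @mdist_radial_map_id _ _ _ hS _ _ l_gt0 l_lt1 r_gt0 p x.
  have := mulr_ge0 (ltW l_gt0) (mdist_ge0 (radial_map S l r p x) x); lra.
- move=> x px; rewrite Gin ?mdistxx// Gout ?px// subr0.
  have -> : radial_map S l r p x = p.
    by rewrite /radial_map radial_factor_small ?px ?lexx ?ltW// hconv0.
  by rewrite -c0 isoc// ?subr0 ?gtr0_norm// in_itv/= lexx ltW.
Qed.

(** Centers that are [4 * r]-separated have disjoint balls of radius [2 * r], while a bump changes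
    [F] only within [r] of its center. The collar between [r] and [2 * r] makes [G] agree near every
    point with a single bump map or with [F]. *)
Lemma exists_perturbation (F : X -> X) :
  (forall x y, mdist (F x) (F y) <= (1 - l) * mdist x y) ->
  exists G : X -> X, [/\ nonexpansive G,
    forall x, mdist (F x) (G x) <= l * r &
    forall z, exists x y, [/\ mdist z x < 4 * r, mdist x y = l * r &
      mdist (G x) (G y) = l * r]].
Proof.
move=> lipF; have lr0 : 0 < l * r by rewrite mulr_gt0.
have lrr : l * r < r by rewrite gtr_pMl.
have r0 := r_gt0; have l1 := l_lt1.
have [|A [sepA maxA]] := @maximal_separated_set (4 * r); first by rewrite mulr_gt0.
have [B HB] := choice (fun p => exists_bump p lipF).
pose near p x := A p /\ mdist p x < 2 * r.
have near_uniq p q x : near p x -> near q x -> p = q.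
  move=> [Ap px] [Aq qx]; apply: sepA => //.
  have := metric_triangle p x q; rewrite (metric_sym x q); lra.
pose G x := if pselect (exists p, near p x) is left ex then B (sval (cid ex)) x
            else F x.
have Gnear p x : near p x -> G x = B p x.
  move=> px; rewrite /G; case: pselect => [ex|]; last by case; exists p.
  by rewrite (near_uniq _ _ _ (svalP (cid ex)) px).
have Gfar x : (forall p, near p x -> r <= mdist p x) -> G x = F x.
  move=> far; rewrite /G; case: pselect => // ex.
  by case: cid => p /= px; have [_ eqF _ _] := HB p; exact: eqF (far _ px).
exists G; split.
- apply: local_nonexpansive => // x.
  have [[p [Ap px]]|nx] := pselect (exists p, near p x).
    exists (2 * r - mdist p x) => [|y xy]; first by rewrite subr_gt0.
    rewrite (Gnear p x)// (Gnear p y); first by have [+ _ _ _] := HB p; apply.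
    by split => //; have := metric_triangle p x y; lra.
  (* A point outside all balls of radius [2 * r] has a ball of radius [r] that meets no bump, so [G]
     is [F] there. *)
  exists r => // y xy; rewrite !Gfar.
  + apply: le_trans (lipF _ _) _; have := mdist_ge0 x y.
    have := mulr_ge0 (ltW l_gt0) (mdist_ge0 x y); lra.
  + move=> p [Ap py]; rewrite leNgt; apply/negP => pyr; apply: nx; exists p.
    split => //; have := metric_triangle p y x; rewrite (metric_sym y); lra.
  + by move=> p px; exfalso; apply: nx; exists p.
- move=> x; rewrite /G; case: pselect => [ex|_]; last by rewrite mdistxx ltW.
  by have [_ _ + _] := HB (sval (cid ex)); apply.
- move=> z; have [p Ap pz] := maxA z.
  have [c cp isoc] := exists_ray p (l * r) geoX hX.
  have pc : mdist p (c (l * r)) = l * r.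
    by rewrite -{1}cp isoc ?sub0r ?normrN ?gtr0_norm// in_itv/= lexx ltW.
  exists p, (c (l * r)); split => //; first by rewrite metric_sym.
  rewrite (Gnear p p) ?(Gnear p (c _))//.
  + by have [_ _ _] := HB p; apply.
  + by split => //; rewrite pc; lra.
  + by split => //; rewrite mdistxx mulr_gt0.
Qed.

End perturbation.
End nonexpansive_maps.

(** * Porosity and the local Lipschitz constant at generic points *)

Lemma porous_at_intro (R : realType) (T : Type) (d : T -> T -> R) (A : set T) (x : T) (a r0 : R) :
  0 < a -> 0 < r0 ->
  (forall r, 0 < r < r0 ->
     exists x', dball d x' (a * r) `<=` dball d x r `\` A) ->
  porous_at d A x.
Proof.
(* The lower limit is a supremum, over the sets of the filter, of infima; the radii between 0 and
   [r0] form one such set, with infimum at least [a]. *)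
move=> a0 r00 H; rewrite /porous_at limf_einfE.
apply: (@lt_le_trans _ _ a%:E); first by rewrite lte_fin.
apply: (@le_trans _ _ (ereal_inf
    [set (porosity_radius d x r A * (r^-1)%:E)%E | r in [set r | 0 < r < r0]])).
  apply: le_ereal_inf_tmp => _ [r /= r0r <-]; have /andP[r_gt0 _] := r0r.
  have -> : a%:E = ((a * r)%:E * (r^-1)%:E)%E.
    by rewrite -EFinM mulfK// gt_eqF.
  apply: lee_wpmul2r; first by rewrite lee_fin invr_ge0 ltW.
  apply: ereal_sup_ubound; exists (a * r) => //; split; last exact: H.
  by rewrite mulr_gt0.
apply: ereal_sup_ubound; exists [set r | 0 < r < r0] => //.
near=> r; apply/andP; split; near: r; first exact: nbhs_right_gt.
exact: nbhs_right_lt.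
Unshelve. all: by end_near.
Qed.

Section generic_lipschitz_constant.
Variables (R : realType) (X : metricType R).
Implicit Types (f : X -> X) (x y z theta : X).

(** The difference quotients are at most 1, and arbitrarily close to [x] some come arbitrarily close
    to 1. Hence [Lip_at f x] equals 1 at every positive radius, and the limit is that of a
    constant. *)
Lemma Lip_eq1 f x : nonexpansive f ->
  (forall k, exists2 y, 0 < mdist x y < k.+1%:R^-1 &
    (1 - k.+1%:R^-1) * mdist x y < mdist (f x) (f y)) ->
  Lip f x = 1.
Proof.
move=> nef Hx.
have Lip_at1 r : 0 < r -> Lip_at f x r = 1.
  move=> r0; rewrite /Lip_at; set E := (X in sup X).
  have ubE : ubound E 1.
    move=> _ [y /andP[y0 _] <-].
    by rewrite ler_pdivrMr// mul1r nef.
  have lbE e : 0 < e -> exists2 t, E t & 1 - e <= t.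
    move=> e0; have [|k] := @ltr_add_invr _ 0 (Num.min r e).
      by rewrite lt_min r0.
    rewrite add0r lt_min => /andP[kr ke].
    have [y /andP[y0 yk] fy] := Hx k.
    exists (mdist (f x) (f y) / mdist x y).
      by exists y => //; rewrite /= y0 (lt_trans yk).
    rewrite ler_pdivlMr//; apply: le_trans (ltW fy).
    by rewrite ler_pM2r// lerD2l lerN2 ltW.
  have E0 : E !=set0 by have [t Et _] := lbE 1 ltr01; exists t.
  apply/eqP; rewrite eq_le ge_sup//=.
  apply/ler_addgt0Pr => e /lbE[t Et].
  rewrite lerBlDr => /le_trans; apply; rewrite lerD2r.
  by apply: ub_le_sup Et; exists 1.
apply: lim_near_cst; first exact: Rhausdorff.
by near=> r; apply: Lip_at1; near: r; exact: nbhs_right_gt.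
Unshelve. all: by end_near.
Qed.

(** The set called N_m in the idea of the proof, with [m.+1] for m. One index governs location,
    radius and contraction rate, which keeps the family countable. *)
Definition contractive_on_ball theta (m : nat) : set (nonexpansive_map X) :=
  [set f | exists z, mdist theta z <= m.+1%:R /\
    forall x y, mdist z x < m.+1%:R^-1 -> mdist z y < m.+1%:R^-1 ->
      mdist (f x) (f y) <= (1 - m.+1%:R^-1) * mdist x y].

Lemma open_expanding f (a : R) : nonexpansive f -> 0 < a <= 1 ->
  open [set x | exists2 y, 0 < mdist x y < a &
    (1 - a) * mdist x y < mdist (f x) (f y)].
Proof.
move=> nef /andP[a0 a1]; rewrite openE => x [y /andP[y0 ya] fy].
(* The same [y] serves all [x'] within [e] of [x]: the first two bounds keep [0 < mdist x' y < a],
   and the third halves the slack because both sides of the expansion inequality move by at most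
   [mdist x x']. *)
pose e := Num.min (mdist x y) (Num.min (a - mdist x y)
  ((mdist (f x) (f y) - (1 - a) * mdist x y) / 2)).
have e0 : 0 < e by rewrite !lt_min y0 subr_gt0 ya divr_gt0// subr_gt0.
apply/nbhs_ballP; exists e => //= x'; rewrite ballEmdist/= => xx'.
move: xx'; rewrite !lt_min => /and3P[x'y x'a x'f].
have tri := metric_triangle x x' y.
have := metric_triangle x' x y; rewrite (metric_sym x' x) => tri'.
exists y; first by apply/andP; split; lra.
have := metric_triangle (f x) (f x') (f y).
have := nef x x'.
have : (1 - a) * mdist x' y <= (1 - a) * (mdist x x' + mdist x y).
  by rewrite ler_wpM2l// subr_ge0.
have : 0 <= a * mdist x x' by rewrite mulr_ge0 ?mdist_ge0// ltW.
lra.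
Qed.

(** The Lipschitz constant is 1 on the intersection of the open sets [U k]. Were some [U k] not
    dense, [f] would contract all close pairs in a ball and so lie in one of the excluded sets. *)
Lemma residual_Lip_eq1 theta (f : nonexpansive_map X) :
  ~ (\bigcup_m contractive_on_ball theta m) f ->
  residual [set x | Lip f x = 1].
Proof.
move=> Nf.
pose U k := [set x | exists2 y, 0 < mdist x y < k.+1%:R^-1 &
    (1 - k.+1%:R^-1) * mdist x y < mdist (f x) (f y)].
have nef := nonexpansive_funP f.
have openU k : open (U k).
  by apply: open_expanding => //; rewrite invr_gt0 invf_le1 ?ler1n ?ltr0n.
(* [meagre] asks for an equality, so the complements are cut down to the exceptional set. *)
exists (fun k => ~` U k `&` ~` [set x | Lip f x = 1]) => [k|].
  apply: contrapT => /eqP/set0P[x].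
  have : closure (~` U k `&` ~` [set x | Lip f x = 1]) `<=` ~` U k.
    rewrite [X in _ `<=` X](_ : _ = closure (~` U k)).
      by apply: closure_subset => ? [].
    by apply/closure_id; rewrite closedC.
  move=> clU /(filterS clU)/nbhs_ballP[e /= e0 xe].
  have d0 := mdist_ge0 theta x.
  (* The three bounds keep the small ball inside the given one, its pairs closer than [k.+1%:R^-1],
     and its center within [m.+1%:R] of [theta]. *)
  have [|m] := @ltr_add_invr _ 0
      (Num.min (Num.min e (k.+1%:R^-1 / 2)) (1 + mdist theta x)^-1).
    by rewrite !lt_min e0 divr_gt0 ?invr_gt0//=; lra.
  rewrite add0r !lt_min => /andP[/andP[me mk]].
  rewrite ltf_pV2 ?posrE ?ltr0n//; last by lra.
  move=> mx; apply: Nf; exists m => //; exists x; split; first by lra.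
  move=> x' y xx' xy; rewrite leNgt; apply/negP => fy.
  have x'y : mdist x' y < k.+1%:R^-1.
    apply: le_lt_trans (metric_triangle x' x y) _.
    by rewrite (metric_sym x' x) (splitr k.+1%:R^-1) ltrD// (lt_trans _ mk).
  have x'y0 : 0 < mdist x' y.
    rewrite mdist_gt0; apply/eqP => E.
    by move: fy; rewrite E !mdistxx mulr0 ltxx.
  apply: (xe x'); first by rewrite ballEmdist/= (lt_trans xx').
  exists y; first by rewrite x'y0.
  apply: le_lt_trans fy; rewrite ler_pM2r// lerD2l lerN2.
  by rewrite ltW// (lt_le_trans mk)// ler_pdivrMr// ler_peMr// ler1n.
apply/seteqP; split=> [x /= nx|x [k _ []//]].
apply: contrapT => Hx; apply: (nx); apply: Lip_eq1 => // k.
by apply: contrapT => nU; apply: Hx; exists k; last split.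
Qed.

(** * Porosity for any distance comparable, on bounded sets, to uniform distance *)

Section porosity.
Variables (S : set (set X)) (theta : X).
Hypotheses (hS : hyperbolic S) (hX : unbounded_space X).
Variable d : nonexpansive_map X -> nonexpansive_map X -> R.
Hypothesis d_triangle : forall f g h : nonexpansive_map X, d f h <= d f g + d g h.
Hypothesis d_upper : exists2 C, 0 < C & forall (f g : nonexpansive_map X) K,
  0 <= K -> (forall x, mdist (f x) (g x) <= K * (1 + mdist theta x)) ->
  d f g <= C * K.
Hypothesis d_lower : forall p : nat, exists c e, [/\ 0 < c, 0 < e &
  forall (f g : nonexpansive_map X) t, d f g < t -> t <= e ->
    forall x, mdist theta x <= p%:R -> mdist (f x) (g x) <= c * t].

Lemma porous_contractive_on_ball m : porous d (contractive_on_ball theta m).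
Proof.
move=> f _; have nef := nonexpansive_funP f.
have [C C0 dC] := d_upper.
(* A ball of radius at most 1 with center within [m.+1%:R] of [theta] stays within [m.+2%:R] of
   it. *)
have [c [e [c0 e0 dc]]] := d_lower m.+2.
have : m.+1%:R^-1 <= 1 :> R by rewrite invf_le1// ler1n.
have : 0 < m.+1%:R^-1 :> R by rewrite invr_gt0.
rewrite /contractive_on_ball; move: (m.+1%:R^-1) => a a0 a1.
(* The expanding pair lies within [4 * r + l * r < a] of [z], hence inside the ball where [h] would
   contract. *)
pose r := a / 8.
pose D := C * (mdist theta (f theta) + r + 1).
have tf0 := mdist_ge0 theta (f theta).
have r0 : 0 < r by rewrite divr_gt0.
have D0 : 0 < D by rewrite mulr_gt0//; lra.
(* The bound [2^-1] keeps the ball of radius [b * t] around [g] inside that of radius [t] around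
   [f]. The other bound makes the error [2 * (c * (b * t))] at most half of the contraction gain
   [a * (l * r)]. *)
pose b := Num.min 2^-1 (a * r / (8 * c * D)).
have cD0 : 0 < 8 * c * D by rewrite mulr_gt0// mulr_gt0.
have ar0 : 0 < a * r by rewrite mulr_gt0.
have b0 : 0 < b by rewrite lt_min invr_gt0 ltr0n divr_gt0.
have b2 : b <= 2^-1 by rewrite ge_min lexx.
have bc : b * (8 * c * D) <= a * r.
  by rewrite -ler_pdivlMr// ge_min lexx orbT.
apply: (porous_at_intro (a := b) (r0 := Num.min (2 * D) (2 * e))) => //.
  by rewrite lt_min (mulr_gt0 _ D0)// mulr_gt0.
move=> t; rewrite lt_min => /andP[t0 /andP[tD te]].
have D20 : 0 < 2 * D by rewrite (mulr_gt0 _ D0).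
(* This choice makes the estimate for [d f g], which is linear in [l], equal to [t / 2]. *)
pose l := t / (2 * D).
have l0 : 0 < l by rewrite divr_gt0.
have l1 : l < 1 by rewrite ltr_pdivrMr// mul1r.
have lD : l * (2 * D) = t by rewrite mulfVK// gt_eqF.
have l01 : 0 <= 1 - l <= 1 by apply/andP; split; lra.
pose F x := hconv S (1 - l) theta (f x).
have lipF x y : mdist (F x) (F y) <= (1 - l) * mdist x y.
  apply: le_trans (hconv_lipschitz hS _ _ _ l01) _.
  by apply: ler_wpM2l; [lra|exact: nef].
have fF x : mdist (f x) (F x) <= l * (mdist theta (f theta) + mdist theta x).
  rewrite -[X in mdist X _](hconv1 hS theta (f x)) mdist_hconv// ?ler01 ?lexx//.
  have -> : 1 - (1 - l) = l by ring.
  rewrite gtr0_norm// ler_pM2l//.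
  by have := metric_triangle theta (f theta) (f x); have := nef theta x; lra.
have [G [neG FG pairG]] := exists_perturbation hS hX l0 l1 r0 lipF.
pose g := NonexpansiveMap neG.
have dfg : d f g <= t / 2.
  have -> : t / 2 = C * (l * (mdist theta (f theta) + r + 1)).
    by rewrite -lD /D; field.
  apply: dC => [|x]; first by rewrite mulr_ge0 ?(ltW l0)//; lra.
  apply: le_trans (metric_triangle _ (F x) _) _.
  apply: le_trans (lerD (fF x) (FG x)) _.
  rewrite -mulrDr -mulrA ler_pM2l//.
  have := mulr_ge0 tf0 (mdist_ge0 theta x).
  have := mulr_ge0 (ltW r0) (mdist_ge0 theta x); lra.
exists g => h /= gh; have bt : b * t <= t / 2.
  by rewrite mulrC ler_pM2l.
split.
  rewrite /dball/= (splitr t); apply: le_lt_trans (d_triangle f g h) _.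
  by rewrite ler_ltD// (lt_le_trans gh).
move=> [z [zm hcontr]].
have [x [y [zx xy Gxy]]] := pairG z.
have rE : 8 * r = a by rewrite /r; field.
have lr : l * r < r by rewrite gtr_pMl.
have zy := metric_triangle z x y.
have close w : mdist z w < a -> mdist (g w) (h w) <= c * (b * t).
  move=> zw; apply: (dc _ _ _ gh); first by lra.
  apply: le_trans (metric_triangle theta z w) _.
  by rewrite -(natr1 m.+1) lerD// (le_trans (ltW zw)).
have := close x ltac:(lra); have := close y ltac:(lra).
have := hcontr x y ltac:(lra) ltac:(lra).
have := metric_triangle (G x) (h x) (G y); rewrite Gxy.
have := metric_triangle (h x) (h y) (G y); rewrite (metric_sym (h y)) xy /g/=.
(* If [h] were contractive, [l * r] would be at most [(1 - a) * (l * r)] plus the error at both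
   points, contradicting this bound. *)
have : 2 * (c * (b * t)) <= a * (l * r) / 2.
  have -> : 2 * (c * (b * t)) = b * (8 * c * D) * l / 2.
    by rewrite -lD; field.
  rewrite ler_pM2r//.
  have -> : a * (l * r) = a * r * l by ring.
  by rewrite ler_pM2r.
have : 0 < a * (l * r) by rewrite mulr_gt0 ?(mulr_gt0 l0).
lra.
Qed.

End porosity.
End generic_lipschitz_constant.

(** * The two metrics and their comparison with uniform distance on balls *)

Lemma inv_on_admissible_gt0 (R : realType) (I : set R) (phi : R -> R) (v : R) :
  admissible I phi -> 0 < v <= 1 -> 0 < inv_on I phi v.
Proof.
move=> adm /andP[v0 v1]; have [u Iu phiu] := adm_C2_one adm.
have I01 t : I t -> 0 < t.
  by case: (adm_dom adm) => -> /=; rewrite in_itv/= => /andP[].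
have Iitv t w : 0 < t -> t <= w -> I w -> I t.
  move=> t0 tw; case: (adm_dom adm) => ->; rewrite /= !in_itv/= t0 => /andP[_].
    exact: le_lt_trans.
  exact: le_trans.
(* (C2) gives a value of [phi] below [v], and [phi u = 1] is at least [v]. By the intermediate value
   theorem [v] is attained, so the inverse lies in [I] and is not the default value 0. *)
have [t [t0 tu tv]] : exists t, [/\ 0 < t, t < u & phi t < v].
  suff /filter_ex : \forall t \near 0^'+, [/\ (0 : R) < t, t < u & phi t < v] by [].
  near=> t; split; near: t.
  - exact: nbhs_right_gt.
  - by apply: nbhs_right_lt; exact: I01.
  - exact: cvgr_lt (adm_C2_lim adm) _ v0.
have [||w wtu phiw] := @IVT _ phi t u v (ltW tu).
- apply: continuous_subspaceW (adm_continuous adm) => w /=.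
  by rewrite in_itv/= => /andP[tw wu]; apply: Iitv wu Iu; exact: lt_le_trans tw.
- by rewrite phiu ge_min le_max (ltW tv) v1 orbT.
have Iw : I w.
  move: wtu; rewrite in_itv/= => /andP[tw wu].
  by apply: Iitv wu Iu; exact: lt_le_trans tw.
have surjI : set_surj I (phi @` I) phi by [].
apply: I01; apply: (surjpinv_image_sub surjI).
by exists v => //; exists w.
Unshelve. all: by end_near.
Qed.

Lemma ratio1D_subadditive (R : realType) (a b c : R) :
  0 <= a -> 0 <= b -> 0 <= c -> a <= b + c ->
  a / (1 + a) <= b / (1 + b) + c / (1 + c).
Proof.
move=> a0 b0 c0 abc.
have pos (x : R) : 0 <= x -> 0 < 1 + x by move=> x0; lra.
have bc := pos _ (addr_ge0 b0 c0).
apply: (@le_trans _ _ ((b + c) / (1 + (b + c)))).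
  rewrite ler_pdivrMr ?pos// mulrAC ler_pdivlMr//; lra.
rewrite [X in X <= _]mulrDl; apply: lerD.
  by rewrite ler_wpM2l// lef_pV2 ?posrE ?pos//; lra.
by rewrite ler_wpM2l// lef_pV2 ?posrE ?pos//; lra.
Qed.

Section distances.
Variables (R : realType) (X : metricType R) (theta : X).
Implicit Types (f g h : nonexpansive_map X) (x : X) (n : nat).

(** Linear growth in the distance from [theta] bounds the sets whose suprema define both metrics. *)
Lemma mdist_nonexpansive_le f g x :
  mdist (f x) (g x) <= mdist (f theta) (g theta) + 2 * mdist theta x.
Proof.
have := metric_triangle (f x) (f theta) (g x).
have := metric_triangle (f theta) (g theta) (g x).
have := nonexpansive_funP f x theta; have := nonexpansive_funP g theta x.
by rewrite (metric_sym x theta); lra.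
Qed.

Lemma dist_ball_ge f g n x : mdist theta x <= n%:R ->
  mdist (f x) (g x) <= dist_ball theta n f g.
Proof.
move=> xn; apply: ub_le_sup; last by exists x.
exists (mdist (f theta) (g theta) + 2 * n%:R) => _ [y /= yn <-].
apply: le_trans (mdist_nonexpansive_le _ _ _) _.
by rewrite lerD2l ler_pM2l.
Qed.

Lemma dist_ball_le f g n (K : R) :
  (forall x, mdist theta x <= n%:R -> mdist (f x) (g x) <= K) ->
  dist_ball theta n f g <= K.
Proof.
move=> H; apply: ge_sup => [|_ [x xn <-]]; last exact: H.
by exists (mdist (f theta) (g theta)); exists theta; rewrite //= mdistxx.
Qed.

Lemma dist_ball_ge0 f g n : 0 <= dist_ball theta n f g.
Proof.
apply: le_trans (dist_ball_ge f g (x := theta) _); first exact: mdist_ge0.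
by rewrite mdistxx.
Qed.

Lemma dist_ball_triangle f g h n :
  dist_ball theta n f h <= dist_ball theta n f g + dist_ball theta n g h.
Proof.
apply: dist_ball_le => x xn; apply: le_trans (metric_triangle _ (g x) _) _.
by apply: lerD; exact: dist_ball_ge.
Qed.

Section dist_phi.
Variables (I : set R) (phi : R -> R).
Hypothesis hphi : admissible I phi.

Let w n := inv_on I phi n.+1%:R^-1.

Let w_gt0 n : 0 < w n.
Proof.
by apply: inv_on_admissible_gt0 => //; rewrite invr_gt0 invf_le1 ?ler1n ltr0n.
Qed.

Let u f g n :=
  w n * (dist_ball theta n.+1 f g / (1 + dist_ball theta n.+1 f g)).

Let u_ge0 f g n : 0 <= u f g n.
Proof.
have D0 := dist_ball_ge0 f g n.+1.
by rewrite mulr_ge0 ?divr_ge0 ?addr_ge0// ltW.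
Qed.

Let cvg_u f g : cvgn (series (u f g)).
Proof.
apply: series_le_cvg (adm_C4 hphi) => [//|n|n].
  by rewrite mulr_ge0// ltW// w_gt0.
rewrite /u mulrC ler_pM2r ?w_gt0//; apply: (@le_trans _ _ 1).
  have D0 := dist_ball_ge0 f g n.+1.
  by rewrite ler_pdivrMr ?mul1r ?lerDr// ltr_wpDr.
by rewrite ler1n.
Qed.

Lemma dist_phi_triangle f g h :
  dist_phi theta I phi f h <=
    dist_phi theta I phi f g + dist_phi theta I phi g h.
Proof.
rewrite /dist_phi -lim_seriesD; [|exact: cvg_u..].
apply: lim_series_le => [||n]; first exact: cvg_u.
  by apply: is_cvg_seriesD; exact: cvg_u.
rewrite /= -mulrDr ler_pM2l ?w_gt0//.
by apply: ratio1D_subadditive; rewrite ?dist_ball_ge0// dist_ball_triangle.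
Qed.

(** On the ball of radius [n.+1] the maps differ by at most [2 * K * n.+1%:R]; the resulting series
    is the one that converges by (C4). *)
Lemma dist_phi_upper : exists2 C, 0 < C & forall f g K, 0 <= K ->
  (forall x, mdist (f x) (g x) <= K * (1 + mdist theta x)) ->
  dist_phi theta I phi f g <= C * K.
Proof.
set v := fun n => n.+1%:R * inv_on I phi n.+1%:R^-1.
have cv : cvgn (series v) := adm_C4 hphi.
have L0 : 0 <= limn (series v).
  have := nondecreasing_cvgn_le _ cv 0; rewrite /series/= big_geq//; apply.
  apply: nondecreasing_series => n _ _.
  by rewrite mulr_ge0// ltW// w_gt0.
exists (2 * limn (series v) + 1) => [|f g K K0 H]; first by rewrite ltr_wpDl// mulr_ge0.
apply: (@le_trans _ _ ((2 * K) * limn (series v))); last first.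
  lra.
rewrite -[X in _ <= X]/((2 * K) *: limn (series v)) -lim_seriesZ//.
apply: lim_series_le => [||n]; [exact: cvg_u|exact: is_cvg_seriesZ|].
have D0 := dist_ball_ge0 f g n.+1.
have -> : ((2 * K) *: v) n = w n * (2 * K * n.+1%:R).
  have -> : ((2 * K) *: v) n = 2 * K * (n.+1%:R * w n) by [].
  by ring.
rewrite ler_pM2l ?w_gt0//.
apply: (@le_trans _ _ (dist_ball theta n.+1 f g)).
  by rewrite ler_pdivrMr ?ler_peMr ?lerDl// ltr_wpDr.
apply: dist_ball_le => x xn; apply: (le_trans (H x)).
have n1 : 1 <= n.+1%:R :> R by rewrite ler1n.
rewrite -mulrA mulrCA ler_wpM2l//; lra.
Qed.

(** A single term of the series is below [t]. With [t <= w p / 2] the inequality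
    [w p * D < t * (1 + D)] can be solved for [D]. *)
Lemma dist_phi_lower p : exists c e, [/\ 0 < c, 0 < e &
  forall f g t, dist_phi theta I phi f g < t -> t <= e ->
    forall x, mdist theta x <= p%:R -> mdist (f x) (g x) <= c * t].
Proof.
have wp := w_gt0 p.
exists (2 / w p), (w p / 2); split; [by rewrite divr_gt0..|].
move=> f g t dt te x xp.
have D0 := dist_ball_ge0 f g p.+1.
have upt : u f g p < t.
  apply: le_lt_trans dt.
  have ndu : {homo series (u f g) : m n / (m <= n)%N >-> m <= n}.
    by apply: nondecreasing_series => n _ _; exact: u_ge0.
  apply: le_trans _ (nondecreasing_cvgn_le ndu (@cvg_u f g) p.+1).
  by rewrite seriesSr lerDr sumr_ge0.
apply: (@le_trans _ _ (dist_ball theta p.+1 f g)).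
  by apply: dist_ball_ge; apply: le_trans xp _; rewrite ler_nat.
have D1 : 0 < 1 + dist_ball theta p.+1 f g by rewrite ltr_wpDr.
move: upt D0 D1; rewrite /u; set D := dist_ball _ _ _ _ => upt D0 D1.
have {}upt : w p * D < t * (1 + D) by rewrite -ltr_pdivrMr// -mulrA.
rewrite mulrAC ler_pdivlMr//.
have : t * D <= w p / 2 * D by rewrite ler_wpM2r.
lra.
Qed.

End dist_phi.

Section dist_pow.
Variable s : R.
Hypothesis hs : 1 <= s.

(** The exponent [s >= 1] enters here: the weight of the metric dominates the linear growth of
    nonexpansive maps. *)
Let le_powR1D (t : R) : 0 <= t -> 1 + t <= 2 * (1 + t `^ s).
Proof.
move=> t0; have ts0 := powR_ge0 t s.
have [t1|/ltW t1] := leP t 1; first by lra.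
have := ler_powR t1 hs; rewrite powRr1//; lra.
Qed.

Let D_gt0 x : 0 < 1 + mdist x theta `^ s.
Proof. by rewrite ltr_wpDr// powR_ge0. Qed.

Let dist_pow_le f g (C : R) :
  (forall x, mdist (f x) (g x) <= C * (1 + mdist x theta `^ s)) ->
  dist_pow theta s f g <= C.
Proof.
move=> H; apply: ge_sup => [|_ [x _ <-]]; last by rewrite ler_pdivrMr.
by eexists; exists theta.
Qed.

Let dist_pow_ge f g x :
  mdist (f x) (g x) <= dist_pow theta s f g * (1 + mdist x theta `^ s).
Proof.
rewrite -ler_pdivrMr//; apply: ub_le_sup; last by exists x.
exists (2 * (mdist (f theta) (g theta) + 2)) => _ [y _ <-].
rewrite ler_pdivrMr//; apply: le_trans (mdist_nonexpansive_le _ _ _) _.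
rewrite (metric_sym theta y).
have d0 := mdist_ge0 (f theta) (g theta).
have t0 := mdist_ge0 y theta.
rewrite -mulrA mulrCA.
apply: le_trans (ler_wpM2l _ (le_powR1D t0)); last by rewrite addr_ge0.
have := mulr_ge0 d0 t0; lra.
Qed.

Lemma dist_pow_triangle f g h :
  dist_pow theta s f h <= dist_pow theta s f g + dist_pow theta s g h.
Proof.
apply: dist_pow_le => x; apply: le_trans (metric_triangle _ (g x) _) _.
by rewrite mulrDl lerD.
Qed.

Lemma dist_pow_upper : exists2 C, 0 < C & forall f g K, 0 <= K ->
  (forall x, mdist (f x) (g x) <= K * (1 + mdist theta x)) ->
  dist_pow theta s f g <= C * K.
Proof.
exists 2 => // f g K K0 H; apply: dist_pow_le => x; apply: (le_trans (H x)).
rewrite (mulrC 2) -mulrA ler_wpM2l// metric_sym.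
by apply: le_powR1D; exact: mdist_ge0.
Qed.

Lemma dist_pow_lower p : exists c e, [/\ 0 < c, 0 < e &
  forall f g t, dist_pow theta s f g < t -> t <= e ->
    forall x, mdist theta x <= p%:R -> mdist (f x) (g x) <= c * t].
Proof.
have p0 : 0 < 1 + p%:R `^ s by rewrite ltr_wpDr// powR_ge0.
exists (1 + p%:R `^ s), 1; split => // f g t dt _ x xp.
apply: le_trans (dist_pow_ge f g x) _; rewrite mulrC.
have d0 : 0 <= dist_pow theta s f g.
  rewrite -(pmulr_lge0 _ (D_gt0 theta)).
  exact: le_trans (mdist_ge0 _ _) (dist_pow_ge f g theta).
apply: ler_pM => //; [exact/ltW|rewrite lerD2l|exact: ltW].
apply: ge0_ler_powR; rewrite ?nnegrE ?mdist_ge0//; last by rewrite metric_sym.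
exact: le_trans ler01 hs.
Qed.

End dist_pow.
End distances.

Theorem theorem6p1 (R : realType) (X : completeMetricType R)
    (S : set (set X)) (hS : hyperbolic S) (hX : unbounded_space X)
    (theta : X) (I : set R) (phi : R -> R) (hphi : admissible I phi)
    (s : R) (hs : 1 <= s) :
  exists N : set (nonexpansive_map X),
    [/\ sigma_porous (fun f g : nonexpansive_map X => dist_phi theta I phi f g) N,
        sigma_porous (fun f g : nonexpansive_map X => dist_pow theta s f g) N
      & forall f : nonexpansive_map X, ~ N f ->
          residual [set x : X | Lip f x = 1]].
Proof.
exists (\bigcup_m contractive_on_ball theta m); split.
- exists (contractive_on_ball theta) => // m.
  apply: (porous_contractive_on_ball hS hX).
  + exact: dist_phi_triangle.
  + exact: dist_phi_upper.
  + exact: dist_phi_lower.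
- exists (contractive_on_ball theta) => // m.
  apply: (porous_contractive_on_ball hS hX).
  + exact: dist_pow_triangle.
  + exact: dist_pow_upper.
  + exact: dist_pow_lower.
- by move=> f; exact: residual_Lip_eq1.
Qed.
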